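(* Let $j\in\mathbb{Z}_{\ge 0}$. Then $$\sum_{n=1}^{\infty}\frac{\binom{2n}{n}}{n^24^n}\,\zeta_n^{\star}(\{2\}_j)=2\sum_{k=0}^{2j+2}(-1)^k\eta(k)\,\eta(2j-k+2),$$ where $\eta(0)=\frac12$ by convention.
   Context: For $n\in\mathbb{Z}_{>0}$ and $j\in\mathbb{Z}_{\ge 0}$, the multiple harmonic star sum is $$\zeta_n^{\star}(\{2\}_j):=\sum_{n\ge n_1\ge\cdots\ge n_j\ge 1}\prod_{i=1}^j\frac{1}{n_i^2},$$ where the $n_i$ are integers, with the convention $\zeta_n^{\star}(\{2\}_0)=\zeta_n^\star(\emptyset)=1$. $\eta$ is the Dirichlet eta function, $\eta(s)=\sum_{n=1}^\infty\frac{(-1)^{n-1}}{n^s}$ for $\Re(s)>0$ (so $\eta(1)=\ln 2$). *)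

(* Defs.v *)
From HB Require Import structures.
From mathcomp Require Import all_boot all_order all_algebra.
From mathcomp Require Import all_classical all_reals all_analysis.

Set Implicit Arguments.
Unset Strict Implicit.
Unset Printing Implicit Defensive.

Import Order.TTheory GRing.Theory Num.Theory numFieldNormedType.Exports.

Local Open Scope classical_set_scope.
Local Open Scope ring_scope.

(* The tuple t is (n_1, ..., n_j), with n >= n_1 >= ... >= n_j >= 1; for
   j = 0 the only summand is the empty product 1. *)
Definition zeta_star2 (R : realType) (n j : nat) : R :=
  \sum_(t : j.-tuple 'I_n.+1 |
          sorted geq [seq val m | m <- t] && all (fun m => 0 < val m)%N t)
     \prod_(m <- t) (1 / (val m)%:R ^+ 2).

(* The Dirichlet eta function at natural arguments; the value at 0 is a
   convention, as the defining series diverges there. *)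
Definition dirichlet_eta (R : realType) (s : nat) : R :=
  if s == 0%N then 1 / 2
  else limn (fun N => \sum_(1 <= n < N) ((-1) ^+ n.-1 / n%:R ^+ s : R)).

(* Main.v *)
Require Import Defs.
From HB Require Import structures.
From mathcomp Require Import all_boot all_order all_algebra.
From mathcomp Require Import all_classical all_reals all_analysis.
From mathcomp Require Import ring zify.

Import Order.TTheory GRing.Theory Num.Theory numFieldNormedType.Exports.

Local Open Scope classical_set_scope.
Local Open Scope ring_scope.

(* Write s = 2j + 2.  Partial fractions of 1 / prod_(i <= n) (1 - x^2 / i^2)
   give
     'C(2n, n) zeta*_n({2}_j) = 2 sum_(1 <= k <= n) (-1)^(k-1) 'C(2n, n+k) / k^(2j),
   so the left-hand side is 2 sum_k (-1)^(k-1) U_k / k^(s-1), where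
   U_k = sum_n k 'C(2n, n+k) / (n^2 4^n).  A Wilf-Zeilberger telescoping gives
   U_k + U_(k+1) = 1 / (k (k+1)), whence
   U_k = 1/k + 2 sum_(m >= 1) (-1)^m / (m + k).  On the other side, summing the
   geometric progression sum_(0 < k < s) (-1)^k p^-k q^(k-s) turns the products
   of partial sums of eta into the same double sum with m and k truncated at N.
   The two truncations differ by O(H_N / N), where H_N is the harmonic number. *)

(** * Binomial coefficients ['C(2n, n+k)]: recurrences and row sums *)

Definition sbin (R : realType) (n k : nat) : R := 'C(2 * n, n + k)%:R.

Lemma sbinSr (R : realType) (n k : nat) :
  sbin R n k.+1 = (n%:R - k%:R) / (n%:R + k%:R + 1) * sbin R n k.
Proof.
have h : (n%:R + k%:R + 1) * sbin R n k.+1 = (n%:R - k%:R) * sbin R n k.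
  rewrite /sbin addnS -!natrD natr1 -natrM mul_bin_left.
  have [le_kn|lt_nk] := leqP k n.
    by rewrite -natrB // -natrM; congr (_ * _)%:R; lia.
  by rewrite bin_small ?muln0 ?mulr0 //; lia.
have nz : n%:R + k%:R + 1 != 0 :> R by rewrite -natrD natr1 pnatr_eq0.
by apply: (mulfI nz); rewrite h; field.
Qed.

Lemma sbinSS (R : realType) (n k : nat) :
  sbin R n.+1 k.+1 = (2 * n%:R + 2) * (2 * n%:R + 1) /
    ((n%:R + k%:R + 2) * (n%:R + k%:R + 1)) * sbin R n k.
Proof.
have h1 : (n%:R + k%:R + 2) * sbin R n.+1 k.+1 =
    (2 * n%:R + 2) * 'C((2 * n).+1, (n + k).+1)%:R.
  rewrite /sbin -!natrD -!natrM -!natrD -!natrM.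
  have -> : (n.+1 + k.+1 = (n + k).+2)%N by lia.
  have -> : (2 * n.+1 = (2 * n).+2)%N by lia.
  by rewrite !addn2 -mul_bin_diag.
have h2 : (n%:R + k%:R + 1) * 'C((2 * n).+1, (n + k).+1)%:R =
    (2 * n%:R + 1) * sbin R n k.
  by rewrite /sbin -!natrM -!natrD -?natrM !natr1 -!natrM -mul_bin_diag.
have nz1 : n%:R + k%:R + 1 != 0 :> R by rewrite -natrD natr1 pnatr_eq0.
have nz2 : n%:R + k%:R + 2 != 0 :> R by rewrite -!natrD pnatr_eq0; lia.
apply: (mulfI nz2); rewrite h1; apply: (mulfI nz1).
by rewrite mulrCA h2; field; rewrite nz1 nz2.
Qed.

(** Kept free of division so as to cover [k = n + 1], where [n + 1 - k] and [sbin R n k] both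
    vanish. *)
Lemma sbinSl (R : realType) (n k : nat) :
  (n%:R + 1 + k%:R) * (n%:R + 1 - k%:R) * sbin R n.+1 k =
  (2 * n%:R + 2) * (2 * n%:R + 1) * sbin R n k.
Proof.
have nz1 : n%:R + k%:R + 1 != 0 :> R by rewrite -natrD natr1 pnatr_eq0.
have nz2 : n%:R + k%:R + 2 != 0 :> R by rewrite -!natrD pnatr_eq0; lia.
have := sbinSS R n k; rewrite sbinSr -natr1 => h.
have nz3 : n%:R + 1 + k%:R + 1 != 0 :> R by rewrite addrAC -addrA.
have : (n%:R + 1 - k%:R) * sbin R n.+1 k =
   (n%:R + 1 + k%:R + 1) *
   ((n%:R + 1 - k%:R) / (n%:R + 1 + k%:R + 1) * sbin R n.+1 k).
  by field.
by move=> e; rewrite -mulrA e h; field; rewrite nz1 nz2.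
Qed.

Lemma sbin_small (R : realType) (n k : nat) : (n < k)%N -> sbin R n k = 0.
Proof. by move=> ltnk; rewrite /sbin bin_small //; lia. Qed.

Lemma sbin_ge0 (R : realType) (n k : nat) : 0 <= sbin R n k.
Proof. exact: ler0n. Qed.

Lemma sum_bin_le (m M : nat) : (\sum_(0 <= i < M) 'C(m, i) <= 2 ^ m)%N.
Proof.
elim: m M => [|m IHm] [|M]; try by rewrite big_geq.
  by rewrite big_nat_recl // big1 // => -[].
rewrite big_nat_recl //= (eq_bigr (fun i => 'C(m, i.+1) + 'C(m, i))%N) //.
rewrite big_split /= addnA expnS mul2n -addnn leq_add ?IHm //.
by have := IHm M.+1; rewrite big_nat_recl // !bin0.
Qed.

(** The coefficients to the right of the middle are part of row [2n] of Pascal's triangle, whose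
    total is [2 ^ (2n)]. *)
Lemma sum_sbin_le (R : realType) (n K : nat) :
  \sum_(1 <= k < K.+1) sbin R n k <= 4 ^+ n.
Proof.
rewrite /sbin -natr_sum -natrX ler_nat (_ : 4 = 2 ^ 2)%N // -expnM.
apply: leq_trans (sum_bin_le (2 * n) (n + K.+1)%N).
rewrite [leqRHS](big_cat_nat (n := n.+1)) //=; last by lia.
rewrite [leqRHS]addnC -[n.+1 in leqRHS]add1n big_addn.
rewrite (_ : n + K.+1 - n = K.+1)%N; last by lia.
by apply: leq_trans (leq_addr _ _); apply: leq_sum => i _; rewrite addnC.
Qed.

(** Case j = 0 of the binomial expansion of the star sums. By Pascal's rule the terms telescope to
    twice ['C(2n-1, n)], which is the central coefficient by symmetry. *)
Lemma alt_sum_sbin (R : realType) (n : nat) : (0 < n)%N ->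
  \sum_(1 <= k < n.+1) 2 * (-1) ^+ k.-1 * sbin R n k = sbin R n 0.
Proof.
case: n => // n _.
pose f k : R := 2 * (-1) ^+ k * 'C((2 * n).+1, (n + k))%:R.
rewrite (eq_big_nat _ _ (F2 := fun k => f k.+1 - f k)); last first.
  case=> // k _; rewrite /f /sbin /=.
  have -> : (2 * n.+1 = (2 * n).+2)%N by lia.
  have -> : (n.+1 + k.+1 = (n + k.+1).+1)%N by lia.
  rewrite [(n + k.+2)%N]addnS binS natrD !exprS; ring.
rewrite telescope_sumr // /f /sbin bin_small; last by lia.
rewrite addn0.
have -> : (2 * n.+1 = (2 * n).+2)%N by lia.
rewrite addn1 [in RHS]binS.
have -> : 'C((2 * n).+1, n) = 'C((2 * n).+1, n.+1).
  by rewrite -[RHS]bin_sub; [congr 'C(_, _); lia|lia].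
by rewrite natrD expr1; ring.
Qed.

(** * Star sums as alternating binomial sums *)

Fixpoint zeta_star2_rec (R : realType) (b j : nat) : R :=
  if j is i.+1 then \sum_(1 <= m < b.+1) zeta_star2_rec R m i / m%:R ^+ 2
  else 1.

(* The bound b on the largest entry is decoupled from the index type 'I_N.+1 so
   that the induction on j stays within tuples over a fixed type. *)
Lemma sum_tuple_zeta_star2 (R : realType) (N b j : nat) : (b <= N)%N ->
  \sum_(t : j.-tuple 'I_N.+1 |
      path geq b [seq val m | m <- t] && all (fun m => 0 < val m)%N t)
     \prod_(m <- t) (1 / (val m)%:R ^+ 2) = zeta_star2_rec R b j.
Proof.
elim: j b => [|j IHj] b le_bN /=.
  rewrite (big_pred1 [tuple]) ?big_nil // => t.
  by rewrite tuple0 /= eqxx.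
pose h (p : 'I_N.+1 * j.-tuple 'I_N.+1) : j.+1.-tuple 'I_N.+1 :=
  [tuple of p.1 :: p.2].
rewrite (reindex h) /=; last first.
  exists (fun t => (thead t, [tuple of behead t])).
    by move=> [x t] _; congr (_, _); apply: val_inj.
  by move=> t _; rewrite /h /= -tuple_eta.
rewrite (eq_bigl (fun p : 'I_N.+1 * j.-tuple 'I_N.+1 =>
    ((0 < p.1) && (p.1 <= b))%N &&
    (path geq p.1 [seq val m | m <- p.2] && all (fun m => 0 < val m)%N p.2)));
  last first.
  by move=> [x t] /=; case: (0 < x)%N; case: (x <= b)%N; rewrite /= ?andbF.
rewrite -(pair_big_dep (fun x : 'I_N.+1 => (0 < x)%N && (x <= b)%N)
  (fun (x : 'I_N.+1) (t : j.-tuple 'I_N.+1) =>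
     path geq x [seq val m | m <- t] && all (fun m => 0 < val m)%N t)
  (fun x t => \prod_(m <- h (x, t)) (1 / (val m)%:R ^+ 2))) /=.
rewrite (eq_bigr (fun x : 'I_N.+1 => zeta_star2_rec R x j / x%:R ^+ 2));
    last first.
  move=> x /andP[_ le_xb]; rewrite -IHj ?(leq_trans le_xb) // mulr_suml.
  by apply: eq_bigr => t _; rewrite big_cons div1r mulrC.
rewrite -(big_mkord (fun x => (0 < x)%N && (x <= b)%N)
  (fun x => zeta_star2_rec R x j / x%:R ^+ 2)).
rewrite (big_cat_nat (n := b.+1)) //= [X in _ + X]big1_seq ?addr0; last first.
  by move=> i; rewrite mem_index_iota; lia.
rewrite big_ltn_cond // ltnn /= [LHS]big_nat_cond [RHS]big_nat_cond.
by apply: eq_bigl => i; lia.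
Qed.

Lemma zeta_star2E (R : realType) (n j : nat) :
  zeta_star2 R n j = zeta_star2_rec R n j.
Proof.
(* Entries of ['I_n.+1] are at most n, so [sorted geq] and [path geq n] agree on [t]. *)
rewrite -(sum_tuple_zeta_star2 R n n j) //; apply: eq_bigl => t; congr (_ && _).
by case: j t => [|j] t; [rewrite tuple0|case: t => -[|x s] //= _; rewrite -ltnS ltn_ord].
Qed.

(* With a(n,k) = 'C(2n,n+k) / 'C(2n,n), the recurrence in n of both sides comes
   from a(n+1,k) (1/k^2 - 1/(n+1)^2) = a(n,k) / k^2. *)
Lemma zeta_star2_recE (R : realType) (n j : nat) : (0 < n)%N ->
  zeta_star2_rec R n j * sbin R n 0 =
  \sum_(1 <= k < n.+1) 2 * (-1) ^+ k.-1 * sbin R n k / k%:R ^+ (2 * j).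
Proof.
elim: j n => [|j IHj] n n_gt0.
  rewrite mul1r -alt_sum_sbin //; apply: eq_bigr => k _.
  by rewrite muln0 expr0 divr1.
elim: n n_gt0 => // n IHn _.
(* [IHn] needs [0 < n]; at n = 0 both sides are empty sums, since the depth [j.+1] is positive. *)
have rec0 : zeta_star2_rec R n j.+1 * sbin R n 0 =
  \sum_(1 <= k < n.+1) 2 * (-1) ^+ k.-1 * sbin R n k / k%:R ^+ (2 * j.+1).
  by case: n IHn => [_|n ->] //; rewrite /= !big_geq // mul0r.
have s0 m : sbin R m 0 != 0 by rewrite /sbin pnatr_eq0 -lt0n bin_gt0; lia.
pose a m k := sbin R m k / sbin R m 0.
have aS m k : (0 < k)%N -> a m.+1 k / k%:R ^+ 2 - a m.+1 k / m.+1%:R ^+ 2 =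
    a m k / k%:R ^+ 2.
  move=> k_gt0; have k0 : k%:R != 0 :> R by rewrite pnatr_eq0; lia.
  have m0 : m%:R + 1 != 0 :> R by rewrite natr1 pnatr_eq0.
  rewrite /a; have := sbinSl R m k; have := sbinSl R m 0.
  have := s0 m; have := s0 m.+1; rewrite -natr1 addr0 subr0.
  move: (sbin R m 0) (sbin R m.+1 0) (sbin R m k) (sbin R m.+1 k) => x y z w.
  move=> y0 x0 e1 e2.
  have q1 : 2 * m%:R + 1 != 0 :> R by rewrite -natrM natr1 pnatr_eq0.
  have q2 : 2 * m%:R + 2 != 0 :> R by rewrite -natrM -natrD addn2 pnatr_eq0.
  have -> : x = (m%:R + 1) * (m%:R + 1) * y /
      ((2 * m%:R + 2) * (2 * m%:R + 1)) by rewrite e1; field; rewrite q1 q2.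
  have -> : z = (m%:R + 1 + k%:R) * (m%:R + 1 - k%:R) * w /
      ((2 * m%:R + 2) * (2 * m%:R + 1)) by rewrite e2; field; rewrite q1 q2.
  by field; rewrite k0 q1 q2 y0 m0.
have conv m i : \sum_(1 <= k < m.+1) 2 * (-1) ^+ k.-1 * sbin R m k / k%:R ^+ i =
   (\sum_(1 <= k < m.+1) 2 * (-1) ^+ k.-1 * a m k / k%:R ^+ i) * sbin R m 0.
  rewrite mulr_suml; apply: eq_bigr => k _.
  rewrite /a -!mulrA; do 3 congr (_ * _).
  by rewrite mulrCA mulVf ?mulr1.
move: rec0 (IHj n.+1 isT); rewrite !conv => /(mulIf (s0 n)) + /(mulIf (s0 n.+1)).
move=> rec0 recj; congr (_ * _).
(* Splitting off n_1 = n+1 leaves the star sum of depth j+1 at n plus that of depth j at n+1 over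
   (n+1)^2. The terms with k <= n match by [aS]; the term k = n+1 comes from the second summand
   alone. *)
rewrite [LHS]/= big_nat_recr //= -/(zeta_star2_rec R n j.+1) rec0 recj.
rewrite [RHS]big_nat_recr //= [X in _ + X / _]big_nat_recr //= mulrDl addrA.
rewrite mulr_suml -big_split /=; congr (_ + _).
  apply: eq_big_nat => k /andP[k_gt0 _].
  rewrite mulnS exprD invfM -[_ * _ / _ ^+ _]mulrA.
  have {aS} := aS n k k_gt0; move: (k%:R ^+ 2)^-1 (n.+1%:R ^+ 2)^-1 => u v e.
  move: (k%:R ^+ (2 * j))^-1 ((-1) ^+ k.-1) => w s.
  rewrite (_ : 2 * s * a n k * (u * w) = 2 * s * w * (a n k * u)); last by ring.
  by rewrite -e; ring.
by rewrite mulnS addnC exprD -[LHS]mulrA [in RHS]invfM.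
Qed.

(** * The sums U_k and the value of U_k + U_(k+1) *)

Definition usum (R : realType) (k N : nat) : R :=
  \sum_(1 <= n < N.+1) k%:R * sbin R n k / (n%:R ^+ 2 * 4 ^+ n).

(* The n-th term of k (k + 1) (U_k + U_(k+1)), in closed form. *)
Definition vterm (R : realType) (k n : nat) : R :=
  k%:R * (k%:R + 1) * (2 * k%:R + 1) * sbin R n k /
    ((n%:R + k%:R + 1) * n%:R * 4 ^+ n).

(* The Wilf-Zeilberger certificate relating vterm k and vterm k.+1. *)
Definition gcert (R : realType) (k n : nat) : R :=
  4 * (k%:R + 1) ^+ 2 * sbin R n k.+1 / (n%:R * 4 ^+ n).

Lemma vtermB (R : realType) (k n : nat) : (0 < n)%N ->
  vterm R k n - vterm R k.+1 n = gcert R k n.+1 - gcert R k n.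
Proof.
move=> n_gt0; rewrite /vterm /gcert sbinSS sbinSr (exprS _ n) -(natr1 n) -(natr1 k).
have n0 : n%:R != 0 :> R by rewrite pnatr_eq0; lia.
have n1 : n%:R + 1 != 0 :> R by rewrite natr1 pnatr_eq0.
have nk1 : n%:R + k%:R + 1 != 0 :> R by rewrite -natrD natr1 pnatr_eq0.
have nk2 : n%:R + k%:R + 2 != 0 :> R by rewrite -!natrD addn2 pnatr_eq0.
have nk3 : n%:R + (k%:R + 1) + 1 != 0 :> R by rewrite addrA -addrA.
have p4 : 4 ^+ n != 0 :> R by rewrite expf_neq0 // pnatr_eq0.
by field; rewrite n0 n1 nk1 nk2 p4.
Qed.

Lemma gcert_ge0 (R : realType) (k n : nat) : 0 <= gcert R k n.
Proof.
by rewrite /gcert -natrX -!natrM natr1 -natrX -!natrM divr_ge0 ?ler0n.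
Qed.

Lemma sbin_le (R : realType) (n k : nat) : sbin R n k.+1 <= 4 ^+ n.
Proof.
apply: le_trans (sum_sbin_le R n k.+1); rewrite big_nat_recr //= lerDr.
by apply: sumr_ge0 => i _; exact: sbin_ge0.
Qed.

Lemma cvg_gcert (R : realType) (k : nat) :
  (fun N : nat => gcert R k N.+1) @ \oo --> (0 : R).
Proof.
apply: (@squeeze_cvgr _ _ _ _ (fun=> 0)
  (fun N => 4 * (k%:R + 1) ^+ 2 * harmonic N)); last 2 first.
- exact: cvg_cst.
- by rewrite -[X in _ --> X](mulr0 (4 * (k%:R + 1) ^+ 2)); apply: cvgMr;
    exact: cvg_harmonic.
apply: nearW => N; rewrite gcert_ge0 /gcert /harmonic /= invfM -mulrA.
rewrite ler_wpM2l ?mulr_ge0 ?exprn_ge0 ?addr_ge0 //.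
by rewrite mulrCA ler_piMr // ler_pdivrMr ?exprn_gt0 // mul1r sbin_le.
Qed.

(** Telescoping in n, then induction on k starting from [vterm R 0 n = 0]. Among the lower boundary
    terms only [gcert R 0 1 = 1] is nonzero. *)
Lemma sum_vterm (R : realType) (k N : nat) :
  \sum_(1 <= n < N.+1) vterm R k.+1 n = 1 - \sum_(i < k.+1) gcert R i N.+1.
Proof.
have step i : \sum_(1 <= n < N.+1) vterm R i.+1 n =
    \sum_(1 <= n < N.+1) vterm R i n - (gcert R i N.+1 - gcert R i 1).
  apply/eqP; rewrite eq_sym subr_eq addrC -subr_eq -sumrB; apply/eqP.
  rewrite -telescope_sumr //; apply: eq_big_nat => n /andP[n_gt0 _].
  exact: vtermB.
elim: k => [|k IHk].
  rewrite (step 0%N) big1 => [|n _]; last by rewrite /vterm !mul0r.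
  by rewrite big_ord1 /(gcert R 0 1) /sbin /= binn; field.
rewrite (step k.+1) IHk [in RHS]big_ord_recr /= /(gcert R k.+1 1) sbin_small //.
by rewrite mulr0 mul0r; ring.
Qed.

Lemma usumD (R : realType) (k N : nat) :
  usum R k.+1 N + usum R k.+2 N =
  (\sum_(1 <= n < N.+1) vterm R k.+1 n) / (k.+1%:R * k.+2%:R).
Proof.
rewrite -big_split mulr_suml; apply: eq_big_nat => n /andP[n_gt0 _] /=.
rewrite /vterm (sbinSr R n k.+1).
have k0 : k.+1%:R != 0 :> R by rewrite pnatr_eq0.
rewrite -(natr1 k.+1); move: {k}k.+1 k0 => k k0.
have n0 : n%:R != 0 :> R by rewrite pnatr_eq0; lia.
have k1 : k%:R + 1 != 0 :> R by rewrite natr1 pnatr_eq0.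
have nk1 : n%:R + k%:R + 1 != 0 :> R by rewrite -natrD natr1 pnatr_eq0.
have p4 : 4 ^+ n != 0 :> R by rewrite expf_neq0 // pnatr_eq0.
by field; rewrite k0 k1 n0 nk1 p4.
Qed.

Lemma usum_ge0 (R : realType) (k N : nat) : 0 <= usum R k N.
Proof.
apply: sumr_ge0 => n _.
by rewrite divr_ge0 ?mulr_ge0 ?exprn_ge0 ?sbin_ge0.
Qed.

(** The discarded boundary terms are nonnegative. The bound is uniform in N, so each U_k converges
    by monotonicity. *)
Lemma usumD_le (R : realType) (k N : nat) :
  usum R k.+1 N + usum R k.+2 N <= (k.+1%:R * k.+2%:R)^-1.
Proof.
rewrite usumD -[leRHS]mul1r ler_wpM2r ?invr_ge0 ?mulr_ge0 //.
rewrite sum_vterm lerBlDr lerDl; apply: sumr_ge0 => i _; exact: gcert_ge0.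
Qed.

Lemma is_cvg_usum (R : realType) (k : nat) : cvgn (usum R k.+1).
Proof.
apply: nondecreasing_is_cvgn.
  apply/nondecreasing_seqP => N; rewrite /usum [leRHS]big_nat_recr //= lerDl.
  by rewrite divr_ge0 ?mulr_ge0 ?exprn_ge0 ?sbin_ge0.
exists (k.+1%:R * k.+2%:R)^-1 => _ [N _ <-].
by apply: le_trans (usumD_le R k N); rewrite lerDl usum_ge0.
Qed.

Lemma lim_usum_ge0 (R : realType) (k : nat) : 0 <= limn (usum R k.+1).
Proof.
by apply: limr_ge; [exact: is_cvg_usum|apply: nearW => N; exact: usum_ge0].
Qed.

Lemma lim_usumD (R : realType) (k : nat) :
  limn (usum R k.+1) + limn (usum R k.+2) = (k.+1%:R * k.+2%:R)^-1.
Proof.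
rewrite -limD; [|exact: is_cvg_usum|exact: is_cvg_usum].
apply/cvg_lim => //.
rewrite [X in X @ _](_ : _ = fun N => (1 - \sum_(i < k.+1) gcert R i N.+1) /
    (k.+1%:R * k.+2%:R)); last by apply/funext => N; rewrite -sum_vterm -usumD.
rewrite -[X in _ --> X]mul1r; apply: cvgMl.
rewrite -[X in _ --> X]subr0; apply: cvgB; first exact: cvg_cst.
have sum0 : \sum_(i < k.+1) (0 : R) = 0 by rewrite big1.
rewrite -[X in _ --> X]sum0.
by apply: cvg_big => [|i _]; [exact: add_continuous|exact: cvg_gcert].
Qed.

(** * U_k as an alternating series, with truncation errors *)

Definition tsum (R : realType) (k N : nat) : R :=
  k%:R^-1 + 2 * \sum_(1 <= m < N.+1) (-1) ^+ m / (m%:R + k%:R).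

(** Pairing neighbours through 1/i - 1/(i+1) = 1/(i(i+1)) produces the main sum of [lim_usumE], so
    that only the last terms remain to be compared. *)
Lemma tsumE (R : realType) (k N : nat) :
  tsum R k.+1 N =
  \sum_(i < N) (-1) ^+ i / ((k + i).+1%:R * (k + i).+2%:R) +
  (-1) ^+ N / (k + N).+1%:R.
Proof.
elim: N => [|N IHN]; first by rewrite /tsum big_geq // big_ord0 addn0; ring.
rewrite /tsum big_nat_recr //= mulrDr addrA -/(tsum R k.+1 N) IHN.
rewrite big_ord_recr /= -!addrA; congr (_ + _).
rewrite (_ : N.+1%:R + k.+1%:R = (k + N).+2%:R); last first.
  by rewrite -natrD; congr (_%:R); lia.
rewrite addnS -(natr1 (k + N).+1) exprS.
move: (k + N)%N ((-1) ^+ N) => m s.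
have m1 : m.+1%:R != 0 :> R by rewrite pnatr_eq0.
have m2 : m.+1%:R + 1 != 0 :> R by rewrite natr1 pnatr_eq0.
by move: (m.+1%:R) m1 m2 => x m1 m2; field; rewrite m1 m2.
Qed.

Lemma lim_usumE (R : realType) (k N : nat) :
  limn (usum R k.+1) =
  \sum_(i < N) (-1) ^+ i / ((k + i).+1%:R * (k + i).+2%:R) +
  (-1) ^+ N * limn (usum R (k + N).+1).
Proof.
elim: N => [|N ->]; first by rewrite big_ord0 addn0 mul1r add0r.
by rewrite big_ord_recr /= -addrA -lim_usumD addnS exprS; ring.
Qed.

Lemma lim_usum_le (R : realType) (k : nat) : limn (usum R k.+1) <= k.+1%:R^-1.
Proof.
apply: (@le_trans _ _ (k.+1%:R * k.+2%:R)^-1).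
  by rewrite -lim_usumD lerDl lim_usum_ge0.
by rewrite invfM ler_piMr // invf_le1 ?ltr0n // ler1n.
Qed.

(** The main sums cancel, leaving two remainders of size at most 1/(k+N+1) each. *)
Lemma dist_lim_usum_tsum (R : realType) (k N : nat) :
  `|limn (usum R k.+1) - tsum R k.+1 N| <= 2 / (k + N).+1%:R.
Proof.
rewrite (lim_usumE R k N) tsumE opprD addrACA subrr add0r -mulrBr normrM.
rewrite normrX normrN1 expr1n mul1r (le_trans (ler_normB _ _)) //.
rewrite !ger0_norm ?lim_usum_ge0 //.
by rewrite (mulrDl 1 1) mul1r lerD2r lim_usum_le.
Qed.

(** The weight 1/k cancels the factor k of [usum]. After exchanging the sums, the row bound [4 ^+ n]
    leaves 1/n^2 <= 1/(n-1) - 1/n, which telescopes to a bound independent of M. *)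
Lemma sum_usumB_le (R : realType) (N M : nat) : (N <= M)%N ->
  \sum_(1 <= k < N.+2) (usum R k M.+1 - usum R k N.+1) / k%:R <= N.+1%:R^-1.
Proof.
move=> le_NM.
rewrite (eq_big_nat _ _ (F2 := fun k =>
    \sum_(N.+2 <= n < M.+2) sbin R n k / (n%:R ^+ 2 * 4 ^+ n))); last first.
  move=> k /andP[k_gt0 _].
  rewrite /usum (big_cat_nat (n := N.+2)) //= [X in X - _]addrC addrK.
  rewrite mulr_suml; apply: eq_bigr => n _; rewrite mulrAC.
  by rewrite [k%:R * _]mulrC mulfK // pnatr_eq0; lia.
rewrite exchange_big_nat //=.
apply: (@le_trans _ _ (\sum_(N.+2 <= n < M.+2) (- n%:R^-1 + n.-1%:R^-1))).
  apply: ler_sum_nat => -[//|n] /andP[n_gt0 _] /=.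
  rewrite -mulr_suml.
  have n0 : 0 < n%:R :> R by rewrite ltr0n; lia.
  apply: (@le_trans _ _ (n.+1%:R ^+ 2)^-1).
    rewrite invfM mulrCA ler_piMr ?invr_ge0 ?exprn_ge0 //.
    by rewrite ler_pdivrMr ?exprn_gt0 // mul1r sum_sbin_le.
  rewrite -natr1; have n1 : 0 < n%:R + 1 :> R by rewrite ltr_wpDl.
  rewrite (_ : - _ + _ = (n%:R * (n%:R + 1))^-1); last first.
    by field; rewrite !gt_eqF.
  by rewrite lef_pV2 ?posrE ?mulr_gt0 // expr2 ler_wpM2r ?lerDl // ltW.
rewrite big_add1 /= (eq_bigr (fun n => (- n.+1%:R^-1) - (- n%:R^-1))).
  rewrite telescope_sumr // opprK gerDr oppr_le0 invr_ge0 //.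
by move=> n _; rewrite opprK.
Qed.

Lemma sum_lim_usumB_le (R : realType) (N : nat) :
  \sum_(1 <= k < N.+2) `|limn (usum R k) - usum R k N.+1| / k%:R <= N.+1%:R^-1.
Proof.
rewrite (eq_big_nat _ _ (F2 := fun k =>
    (limn (usum R k) - usum R k N.+1) / k%:R)); last first.
  case=> // k _; rewrite ger0_norm // subr_ge0.
  apply: nondecreasing_cvgn_le; last exact: is_cvg_usum.
  apply/nondecreasing_seqP => n; rewrite /usum [leRHS]big_nat_recr //= lerDl.
  by rewrite divr_ge0 ?mulr_ge0 ?exprn_ge0 ?sbin_ge0.
have h : (fun M => \sum_(1 <= k < N.+2) (usum R k M.+1 - usum R k N.+1) / k%:R)
   @ \oo --> \sum_(1 <= k < N.+2) (limn (usum R k) - usum R k N.+1) / k%:R.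
  rewrite [X in _ --> X]big_nat_cond.
  under eq_fun do rewrite big_nat_cond.
  apply: cvg_big => [|[//|k] _]; first exact: add_continuous.
  apply: cvgMl; apply: cvgB; last exact: cvg_cst.
  by have := is_cvg_usum R k; rewrite -cvg_shiftS.
rewrite -(cvg_lim _ h) //; apply: limr_le; first by apply/cvg_ex; eexists; exact: h.
by exists N => // M /= le_NM; exact: sum_usumB_le.
Qed.

(** * Partial sums of both sides as double sums *)

Definition eta_psum (R : realType) (s N : nat) : R :=
  if s == 0%N then 1 / 2
  else \sum_(1 <= n < N.+1) (-1) ^+ n.-1 / n%:R ^+ s.

(** Factor u^m - v^m with u = 1/y, v = -1/x and m = 2j+1; since m is odd, the difference becomes a
    sum of inverse powers. *)
Lemma sum_alt_geometric (F : fieldType) (x y : F) (j : nat) :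
  x != 0 -> y != 0 -> x + y != 0 ->
  \sum_(1 <= k < 2 * j + 2) (-1) ^+ k / (x ^+ k * y ^+ (2 * j + 2 - k)) =
  - (x ^- (2 * j + 1) + y ^- (2 * j + 1)) / (x + y).
Proof.
move=> x0 y0 xy0.
have := subrXX (y^-1) (- x^-1) (2 * j + 1).
rewrite [X in _ - X = _]exprNn -signr_odd oddD oddM /= expr1 mulN1r !opprK.
rewrite !exprVn => e.
rewrite [X in - X / _]addrC e big_add1 big_mkord.
rewrite (_ : (2 * j + 2).-1 = 2 * j + 1)%N; last by lia.
rewrite (_ : _ / (x + y) = - (x * y)^-1 * \sum_(i < 2 * j + 1)
    y^-1 ^+ ((2 * j + 1).-1 - i) * (- x^-1) ^+ i); last by field; rewrite x0 y0 xy0.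
rewrite mulr_sumr; apply: eq_bigr => i _.
rewrite (_ : 2 * j + 2 - i.+1 = ((2 * j + 1).-1 - i).+1)%N; last first.
  by have := ltn_ord i; lia.
rewrite !exprS (exprNn x^-1) !exprVn.
have := expf_neq0 i x0; have := expf_neq0 ((2 * j + 1).-1 - i) y0.
move: (x ^+ i) (y ^+ _) ((-1) ^+ i) => u v w v0 u0.
by field; rewrite x0 y0 u0 v0.
Qed.

(** The end terms, where one factor is the conventional 1/2, supply the 1/p part of [tsum]. The
    inner terms give -2S: the two halves of the closed geometric sum are exchanged by swapping p and
    q. *)
Lemma sum_eta_psum (R : realType) (j N : nat) :
  2 * \sum_(0 <= k < (2 * j + 2).+1)
     (-1) ^+ k * eta_psum R k N * eta_psum R (2 * j + 2 - k) N =
  2 * \sum_(1 <= p < N.+1) (-1) ^+ p.-1 / p%:R ^+ (2 * j + 1) * tsum R p N.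
Proof.
have sgn : (-1) ^+ (2 * j + 2) = 1 :> R by rewrite -signr_odd oddD oddM.
rewrite big_nat_recr //= big_ltn; last by lia.
rewrite subnn subn0 sgn expr0 !mul1r.
rewrite {1 4}/eta_psum /=.
pose S := \sum_(1 <= p < N.+1) \sum_(1 <= q < N.+1)
  (-1) ^+ (p + q) / (p%:R ^+ (2 * j + 1) * (q%:R + p%:R)) : R.
rewrite (_ : \sum_(1 <= k < 2 * j + 2) _ = - (2 * S)); last first.
  rewrite (eq_big_nat _ _ (F2 := fun k => \sum_(1 <= p < N.+1)
     \sum_(1 <= q < N.+1) (-1) ^+ (p + q) *
       ((-1) ^+ k / (p%:R ^+ k * q%:R ^+ (2 * j + 2 - k))))); last first.
    move=> k /andP[k_gt0 k_lt].
    rewrite /eta_psum !gtn_eqF ?subn_gt0 // -mulrA mulr_suml mulr_sumr.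
    apply: eq_big_nat => p /andP[p_gt0 _]; rewrite !mulr_sumr.
    apply: eq_big_nat => q /andP[q_gt0 _].
    case: p p_gt0 => // p _; case: q q_gt0 => // q _ /=.
    by rewrite exprD !(exprS (-1)) invfM; ring.
  rewrite exchange_big_nat //=.
  rewrite (eq_big_nat _ _ (F2 := fun p => \sum_(1 <= q < N.+1)
     (- ((-1) ^+ (p + q) / (p%:R ^+ (2 * j + 1) * (q%:R + p%:R))) -
      ((-1) ^+ (q + p) / (q%:R ^+ (2 * j + 1) * (p%:R + q%:R)))))); last first.
    move=> p /andP[p_gt0 _]; rewrite exchange_big_nat //=.
    apply: eq_big_nat => q /andP[q_gt0 _].
    have p0 : p%:R != 0 :> R by rewrite pnatr_eq0 -lt0n.
    have q0 : q%:R != 0 :> R by rewrite pnatr_eq0 -lt0n.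
    have pq0 : p%:R + q%:R != 0 :> R by rewrite -natrD pnatr_eq0; lia.
    rewrite -mulr_sumr sum_alt_geometric // [(q + p)%N]addnC [q%:R + _]addrC.
    rewrite !invfM; ring.
  under eq_bigr do rewrite big_split sumrN sumrN /=.
  rewrite big_split sumrN sumrN /= [X in _ - X]exchange_big_nat //= -/S; ring.
rewrite [in RHS]/tsum.
rewrite [in RHS](eq_big_nat _ _ (F2 := fun p =>
    (-1) ^+ p.-1 / p%:R ^+ (2 * j + 2) -
    2 * \sum_(1 <= q < N.+1)
      (-1) ^+ (p + q) / (p%:R ^+ (2 * j + 1) * (q%:R + p%:R)))); last first.
  move=> p /andP[p_gt0 _]; rewrite mulrDr; congr (_ + _).
    by rewrite -mulrA -invfM -exprSr -addnS.
  rewrite mulrCA -mulrN; congr (_ * _); rewrite mulr_sumr -sumrN.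
  apply: eq_bigr => q _; case: p p_gt0 => // p _.
  by rewrite (exprD (-1)) (exprS (-1)) invfM /=; ring.
by rewrite sumrB -mulr_sumr -/S /eta_psum addn2 /=; field.
Qed.

(** The expansion over k <= n extends to k <= N because [sbin R n k] vanishes beyond n; the two sums
    can then be exchanged. *)
Lemma sum_zeta_star2E (R : realType) (j N : nat) :
  \sum_(1 <= n < N.+1)
     ('C(2 * n, n)%:R / (n%:R ^+ 2 * 4 ^+ n) * zeta_star2 R n j) =
  2 * \sum_(1 <= k < N.+1) (-1) ^+ k.-1 / k%:R ^+ (2 * j + 1) * usum R k N.
Proof.
rewrite (eq_big_nat _ _ (F2 := fun n => \sum_(1 <= k < N.+1)
  2 * (-1) ^+ k.-1 * sbin R n k / k%:R ^+ (2 * j) / (n%:R ^+ 2 * 4 ^+ n))).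
  rewrite exchange_big_nat //= mulr_sumr; apply: eq_big_nat => k /andP[k_gt0 _].
  have k0 : k%:R != 0 :> R by rewrite pnatr_eq0 -lt0n.
  rewrite /usum !mulr_sumr; apply: eq_bigr => n _.
  rewrite exprD expr1; move: (_ ^+ _ * _)^-1 => c.
  by field; rewrite k0 expf_neq0.
move=> n /andP[n_gt0 n_le]; rewrite zeta_star2E mulrAC [_%:R * _]mulrC.
have := zeta_star2_recE R n j n_gt0; rewrite {1}/sbin addn0 => ->.
rewrite (big_cat_nat (n := n.+1) (p := N.+1)) //= [X in _ + X]big1_seq ?addr0.
  by rewrite mulr_suml.
move=> k; rewrite mem_index_iota => /andP[_ /andP[lt_nk _]].
by rewrite sbin_small // mulr0 !mul0r.
Qed.

(** * Convergence and passage to the limit *)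

(* Averaging consecutive partial sums turns the alternating series into one
   whose absolute values telescope. *)
Lemma is_cvg_alternating_series (R : realType) (b : R ^nat) :
  nonincreasing_seq b -> b @ \oo --> (0 : R) ->
  cvgn (series (fun i => (-1) ^+ i * b i)).
Proof.
move=> b_ni b0.
pose w i := (-1) ^+ i * (b i - b i.+1).
have w_norm i : `|w i| = b i - b i.+1.
  by rewrite normrM normrX normrN1 expr1n mul1r ger0_norm // subr_ge0 b_ni.
have /cvg_ex[W cvgW] : cvgn (series w).
  apply: normed_cvg.
  rewrite [X in cvgn X](_ : _ = (fun n => b 0%N - b n)); last first.
    apply/funext => n; rewrite /= /series /=; under eq_bigr do rewrite w_norm.
    rewrite -[RHS]opprB -telescope_sumr // -sumrN.
    by apply: eq_bigr => i _; rewrite opprB.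
  by apply/cvg_ex; exists (b 0%N - 0); apply: cvgB => //; exact: cvg_cst.
have sumE : series (fun i => (-1) ^+ i * b i) =
    (fun n => 2^-1 * (b 0%N + series w n - (-1) ^+ n * b n)).
  apply/funext => n; elim: n => [|n IHn].
    by rewrite /series /= !big_geq //; ring.
  rewrite !seriesSr IHn /w exprS.
  by field.
have sgn_b0 : (fun n => (-1) ^+ n * b n) @ \oo --> (0 : R).
  apply/norm_cvg0P; under eq_fun do rewrite normrM normrX normrN1 expr1n mul1r.
  exact/norm_cvg0P.
rewrite sumE; apply/cvg_ex; exists (2^-1 * (b 0%N + W - 0)).
by apply: cvgMr; apply: cvgB => //; apply: cvgD => //; exact: cvg_cst.
Qed.

(** At s = 1 the series converges only conditionally, hence the alternating test for all positive
    s. *)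
Lemma cvg_eta_psum (R : realType) (s : nat) :
  eta_psum R s @ \oo --> dirichlet_eta R s.
Proof.
rewrite /eta_psum /dirichlet_eta; case: s => [|s] /=; first exact: cvg_cst.
pose b n : R := n.+1%:R ^- s.+1.
have sumE N : \sum_(1 <= n < N.+1) (-1) ^+ n.-1 / n%:R ^+ s.+1 =
    series (fun i => (-1) ^+ i * b i) N by rewrite big_add1.
have cvgb : cvgn (series (fun i => (-1) ^+ i * b i)).
  apply: is_cvg_alternating_series.
    apply/nonincreasing_seqP => n; rewrite lef_pV2 ?posrE ?exprn_gt0 //.
    by rewrite lerXn2r ?nnegrE // ler_nat.
  apply: (@squeeze_cvgr _ _ _ _ (fun=> 0) harmonic); last 2 first.
  - exact: cvg_cst.
  - exact: cvg_harmonic.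
  apply: nearW => n; rewrite invr_ge0 exprn_ge0 //=.
  by rewrite lef_pV2 ?posrE ?exprn_gt0 // exprS ler_peMr // exprn_ege1 // ler1n.
(* The sums in [dirichlet_eta] stop at [n < N], one term before [eta_psum], hence the shift.
   Convergence must be known before [limn] can be identified. *)
have h : (fun N => \sum_(1 <= n < N) (-1) ^+ n.-1 / n%:R ^+ s.+1) @ \oo -->
    limn (series (fun i => (-1) ^+ i * b i)).
  by rewrite -cvg_shiftS /=; under eq_fun do rewrite sumE.
by rewrite (cvg_lim _ h) //; under eq_fun do rewrite sumE.
Qed.

(** Insert U_k between [usum] and [tsum], and bound k^-(2j+1) by 1/k. The first gap sums to at most
    1/(N+1); the second is at most 2/(N+1) for each k, which yields 2 H_(N+1)/(N+1), twice the
    Cesaro mean of [harmonic]. *)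
Lemma dist_sum_usum_tsum (R : realType) (j N : nat) :
  `|2 * \sum_(1 <= k < N.+2) (-1) ^+ k.-1 / k%:R ^+ (2 * j + 1) * usum R k N.+1 -
    2 * \sum_(1 <= k < N.+2) (-1) ^+ k.-1 / k%:R ^+ (2 * j + 1) * tsum R k N.+1|
  <= 2 * (harmonic N + 2 * arithmetic_mean harmonic N).
Proof.
rewrite -mulrBr normrM ger0_norm // ler_wpM2l // -sumrB.
have -> : 2 * arithmetic_mean harmonic N =
    \sum_(1 <= k < N.+2) (2 / N.+1%:R) / k%:R :> R.
  rewrite /arithmetic_mean /series /= mulrA mulr_sumr [RHS]big_add1 /=.
  by apply: eq_bigr.
apply: le_trans (lerD (sum_lim_usumB_le R N) (lexx _)).
rewrite -big_split /= (le_trans (ler_norm_sum _ _ _)) //.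
apply: ler_sum_nat => -[//|k] _ /=.
rewrite -mulrBr normrM normf_div normrX normrN1 expr1n.
rewrite [`|_ ^+ (2 * j + 1)|]ger0_norm ?exprn_ge0 //.
rewrite -mulrDl mulrC div1r ler_pM ?normr_ge0 ?invr_ge0 ?exprn_ge0 //.
  apply: le_trans (ler_distD (limn (usum R k.+1)) _ _) _.
  rewrite distrC lerD2l (le_trans (dist_lim_usum_tsum R k N.+1)) //.
  by rewrite ler_wpM2l // lef_pV2 ?posrE // ler_nat; lia.
by rewrite lef_pV2 ?posrE ?exprn_gt0 // addn1 exprS ler_peMr // exprn_ege1 // ler1n.
Qed.

Theorem proposition3p3 (R : realType) (j : nat) :
  (fun N : nat => \sum_(1 <= n < N)
     ('C(2 * n, n)%:R / (n%:R ^+ 2 * 4 ^+ n) * zeta_star2 R n j : R)) @ \oo -->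
  (2 * \sum_(0 <= k < (2 * j + 2).+1)
     (-1) ^+ k * dirichlet_eta R k * dirichlet_eta R (2 * j + 2 - k) : R).
Proof.
(* One shift makes the range n <= N; the other replaces N by N+1, to match the error bound in
   [harmonic N] = 1/(N+1). *)
rewrite -cvg_shiftS -cvg_shiftS /=.
apply: (@cvg_sub0 _ _ _ _ _ _ (fun N => 2 * \sum_(0 <= k < (2 * j + 2).+1)
  (-1) ^+ k * eta_psum R k N.+1 * eta_psum R (2 * j + 2 - k) N.+1)); last first.
  rewrite (cvg_shiftS (fun N => 2 * \sum_(0 <= k < (2 * j + 2).+1)
    (-1) ^+ k * eta_psum R k N * eta_psum R (2 * j + 2 - k) N)).
  apply: cvgMr; apply: cvg_big => [|k _]; first exact: add_continuous.
  by apply: cvgM; [apply: cvgMr|]; exact: cvg_eta_psum.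
apply/norm_cvg0P.
apply: (@squeeze_cvgr _ _ _ _ (fun=> 0)
  (fun N => 2 * (harmonic N + 2 * arithmetic_mean harmonic N))).
- apply: nearW => N; rewrite normr_ge0 /=.
  by have := dist_sum_usum_tsum R j N; rewrite -sum_eta_psum -sum_zeta_star2E.
- exact: cvg_cst.
rewrite -[X in _ --> X](mulr0 2); apply: cvgMr.
rewrite -[X in _ --> X]addr0 -[X in _ --> _ + X](mulr0 2).
apply: cvgD; first exact: cvg_harmonic.
by apply: cvgMr; apply: cesaro; exact: cvg_harmonic.
Qed.
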